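(* There is a function $h(n)=\Theta(n)$ such that for every integer $n\ge 8$, $$\psi'_c(K_n)\le \frac{1}{\sqrt2}\,n^{3/2}+h(n).$$
   Context: $K_n$ is the complete graph on $n$ vertices and $[k]=\{1,\dots,k\}$. For a finite simple graph $H$, a complete $k$-coloring of $H$ is a (not necessarily proper) map $\varsigma\colon V(H)\to[k]$ such that for each pair of different colors $i,j\in[k]$ there is an edge $xy\in E(H)$ with $x\in\varsigma^{-1}(i)$ and $y\in\varsigma^{-1}(j)$. It is connected if each color class $\varsigma^{-1}(i)$ induces a connected subgraph of $H$. For a connected graph $H$, $\psi_c(H)$ is the largest $k$ for which $H$ has a connected and complete $k$-coloring. The connected-pseudoachromatic index of a graph $G$ is $\psi'_c(G)=\psi_c(L(G))$, where $L(G)$ is the line graph of $G$. Equivalently, $\psi'_c(K_n)$ is the largest $k$ for which the edges of $K_n$ can be colored with $k$ colors so that each color class of edges forms a connected subgraph and every two color classes share at least one vertex. A real-valued function $h$ satisfies $h(n)=\Theta(n)$ if there are constants $c_1,c_2>0$ with $c_1 n\le |h(n)|\le c_2 n$ for all sufficiently large $n$. *)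

(* Defs.v *)
From HB Require Import structures.
From mathcomp Require Import all_boot all_order all_algebra.
From mathcomp Require Import all_classical all_reals all_analysis.

Set Implicit Arguments.
Unset Strict Implicit.
Unset Printing Implicit Defensive.

Import Order.TTheory GRing.Theory Num.Theory.

Record sgraph := SGraph {
  vertex :> finType;
  adj : rel vertex;
  adj_sym : symmetric adj;
  adj_irrefl : irreflexive adj }.

Arguments adj {s}.

(* A connected graph has at least one vertex. *)
Definition connected_graph (G : sgraph) : bool :=
  (0 < #|G|)%N && [forall x : G, forall y : G, connect adj x y].

Section Constructions.
Variable G : sgraph.

Definition edges : {set {set G}} :=
  [set [set p.1; p.2] | p in [set p : G * G | adj p.1 p.2]].

Definition induced_vertex (S : {set G}) := {x : G | x \in S}.

Definition induced_adj (S : {set G}) : rel (induced_vertex S) :=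
  fun u v => adj (val u) (val v).

Fact induced_adj_sym S : symmetric (@induced_adj S).
Proof. by move=> u v; apply: adj_sym. Qed.

Fact induced_adj_irrefl S : irreflexive (@induced_adj S).
Proof. by move=> u; apply: adj_irrefl. Qed.

Definition induced (S : {set G}) : sgraph :=
  SGraph (@induced_adj_sym S) (@induced_adj_irrefl S).

Definition line_vertex := {e : {set G} | e \in edges}.

Definition line_adj : rel line_vertex :=
  fun e f => (e != f) && (val e :&: val f != finset.set0).

Fact line_adj_sym : symmetric line_adj.
Proof. by move=> e f; rewrite /line_adj eq_sym finset.setIC. Qed.

Fact line_adj_irrefl : irreflexive line_adj.
Proof. by move=> e; rewrite /line_adj eqxx. Qed.

Definition line_graph : sgraph := SGraph line_adj_sym line_adj_irrefl.

End Constructions.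

Section Complete.
Variable n : nat.

Definition complete_adj : rel 'I_n := fun i j => i != j.

Fact complete_adj_sym : symmetric complete_adj.
Proof. by move=> i j; rewrite /complete_adj eq_sym. Qed.

Fact complete_adj_irrefl : irreflexive complete_adj.
Proof. by move=> i; rewrite /complete_adj eqxx. Qed.

Definition complete_graph : sgraph :=
  SGraph complete_adj_sym complete_adj_irrefl.

End Complete.

Section Colorings.
Variable H : sgraph.

Definition color_class k (c : {ffun H -> 'I_k}) (i : 'I_k) : {set H} :=
  [set x | c x == i].

Definition complete_coloring k (c : {ffun H -> 'I_k}) : bool :=
  [forall i : 'I_k, forall j : 'I_k, (i != j) ==>
    [exists x in color_class c i, exists y in color_class c j, adj x y]].

Definition connected_coloring k (c : {ffun H -> 'I_k}) : bool :=
  [forall i : 'I_k, connected_graph (induced (color_class c i))].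

Definition has_cc_coloring (k : nat) : bool :=
  [exists c : {ffun H -> 'I_k}, connected_coloring c && complete_coloring c].

(* Color classes being nonempty, at most #|H| colors can occur, so the bound
   on k is harmless: see [psi_c_max] and [psi_c_attained]. *)
Definition psi_c : nat := \max_(k < #|H|.+1 | has_cc_coloring k) k.

Lemma has_cc_coloring_leq k : has_cc_coloring k -> (k <= #|H|)%N.
Proof.
case/existsP=> c /andP[/forallP cc _].
have sc (i : 'I_k) : exists x : H, c x == i.
  have /andP[/card_gt0P[[x xi] _] _] := cc i.
  by exists x; move: xi; rewrite inE.
have inj : injective (fun i => xchoose (sc i)).
  move=> i j eij; rewrite -(eqP (xchooseP (sc i))) -(eqP (xchooseP (sc j))).
  by congr (c _).
by rewrite -[leqLHS]card_ord; apply: leq_card inj.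
Qed.

Lemma psi_c_max k : has_cc_coloring k -> (k <= psi_c)%N.
Proof.
move=> ck; have lek := has_cc_coloring_leq ck.
exact: (leq_bigmax_cond (Ordinal (lek : (k < #|H|.+1)%N)) ck).
Qed.

Lemma connected_has_cc_coloring1 : connected_graph H -> has_cc_coloring 1.
Proof.
case/andP=> /card_gt0P[x0 _] /forallP cH; apply/existsP; exists [ffun=> ord0].
apply/andP; split; apply/forallP=> i; last first.
  by apply/forallP=> j; rewrite (ord1 i) (ord1 j) eqxx.
have allS x : x \in color_class [ffun=> ord0] i by rewrite inE ffunE (ord1 i).
apply/andP; split; first by apply/card_gt0P; exists (Sub x0 (allS x0)).
apply/forallP=> -[x xS]; apply/forallP=> -[y yS].
have /forallP/(_ y)/connectP[p] := cH x.
elim: p x xS => [|z p IHp] x xS /=.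
  by move=> _ eyx; rewrite (_ : exist _ y yS = exist _ x xS) //; apply/val_inj.
case/andP=> xz pz ey; apply: connect_trans (IHp z (allS z) pz ey).
exact: connect1.
Qed.

Lemma psi_c_attained : connected_graph H -> has_cc_coloring psi_c.
Proof.
move=> /connected_has_cc_coloring1 c1.
have lt1 : (1 < #|H|.+1)%N by rewrite ltnS has_cc_coloring_leq.
rewrite /psi_c (bigop.bigmax_eq_arg (Ordinal lt1)) //.
by case: arg_maxnP.
Qed.

End Colorings.

Definition connected_pseudoachromatic_index (G : sgraph) : nat :=
  psi_c (line_graph G).

Local Open Scope ring_scope.
Local Open Scope classical_set_scope.

Definition Theta_n (R : realType) (h : nat -> R) : Prop :=
  exists c1 c2 : R, [/\ 0 < c1, 0 < c2 &
    \forall n \near \oo, c1 * n%:R <= `|h n| /\ `|h n| <= c2 * n%:R].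

(* Main.v *)
Require Import Defs.
From mathcomp Require Import all_boot all_order all_algebra.
From mathcomp Require Import all_classical all_reals all_analysis.
From mathcomp Require Import zify lra.

(** Compare the number [k] of colors with the size [e] of a smallest color
    class [S], in any graph [G] on [n] vertices.  On the one hand [k * e] is at
    most the number of edges, hence at most [n ^ 2 / 2].  On the other hand [S]
    is connected, so it covers at most [e + 1] vertices
    ([card_covered_connected]); every color has an edge at one of these vertices
    and only [n] edges pass through each of them, so [k <= (e + 1) * n].
    Multiplying the latter inequality by [k] and eliminating [k * e] gives
    [k ^ 2 <= n ^ 3 / 2 + k * n] ([cc_coloring_quadratic_bound]).  With
    [a ^ 2 = n ^ 3 / 2] this reads [k * (k - n) <= a ^ 2], which fails as soon
    as [k > a + n]; hence the linear error term can be taken to be [h n = n]. *)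

Import Order.TTheory GRing.Theory Num.Theory.
Local Open Scope ring_scope.

Section LineGraphColorings.
Local Open Scope nat_scope.
Variable G : sgraph.
Implicit Types (S T : {set line_graph G}) (e f : line_graph G) (x : G).

Definition covered S : {set G} := \bigcup_(e in S) val e.

Lemma card_edge_leq2 e : #|val e| <= 2.
Proof.
have /imsetP[p _ ->] := valP e.
by rewrite cards2; case: (_ != _).
Qed.

Lemma edge_neq0 e : val e != finset.set0.
Proof.
have /imsetP[p _ ->] := valP e.
by apply/set0Pn; exists p.1; rewrite !inE eqxx.
Qed.

Lemma card_edges_leq : (#|line_graph G|).*2 <= #|G| ^ 2.
Proof.
have -> : #|line_graph G| = #|edges G| by rewrite card_sig; apply: eq_card.
have sub : edges G \subset [set A : {set G} | #|A| == 2].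
  apply/fintype.subsetP=> A /imsetP[p]; rewrite inE => adjp ->.
  rewrite inE cards2; have [p12|//] := eqVneq p.1 p.2.
  by move: adjp; rewrite p12 adj_irrefl.
have := subset_leq_card sub.
rewrite card_draws bin2; nia.
Qed.

Lemma card_edges_at_leq x : #|[set e : line_graph G | x \in val e]| <= #|G|.
Proof.
rewrite -(card_imset _ val_inj).
apply: (@leq_trans #|[set [set x; y] | y in G]|); last exact: leq_imset_card.
apply/subset_leq_card/fintype.subsetP=> A /imsetP[e]; rewrite inE => xe ->.
have /imsetP[p _ ep] := valP e.
move: xe; rewrite ep !inE => /orP[/eqP->|/eqP->].
- by apply/imsetP; exists p.2.
- by apply/imsetP; exists p.1 => //; rewrite finset.setUC.
Qed.

(** Adding to a set of edges an edge that meets it covers at most one new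
    vertex.  A largest subset of [S] built in this way is all of [S], since
    otherwise connectedness provides one more edge to add. *)
Lemma card_covered_connected S :
  connected_graph (Defs.induced S) -> #|covered S| <= #|S|.+1.
Proof.
case/andP=> /card_gt0P[[e0 e0S] _] /forallP conS.
pose P T := [&& T \subset S, T != finset.set0 & #|covered T| <= #|T|.+1].
have P0 : P [set e0].
  rewrite /P finset.sub1set e0S /covered big_set1 cards1 card_edge_leq2 !andbT /=.
  by apply/set0Pn; exists e0; rewrite inE.
case: (arg_maxnP (fun T : {set _} => #|T|) P0) => T.
case/and3P=> TS /set0Pn[t tT] covT maxT.
have [<- //|neqTS] := eqVneq T S.
have /subsetPn[s sS sNT] : ~~ (S \subset T).
  by apply: contra neqTS => ST; rewrite finset.eqEsubset TS.
have [/exists_inP[e eST meet]|] :=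
  boolP [exists e in S :\: T, val e :&: covered T != finset.set0].
  have [eS eNT] := setDP eST.
  suff /maxT : P (e |: T) by rewrite /= cardsU1 eNT add1n ltnn.
  apply/and3P; split; first by rewrite finset.subUset finset.sub1set eS TS.
  - by apply/set0Pn; exists e; rewrite !inE eqxx.
  - rewrite /covered big_setU1 // -/(covered T) cardsU1 eNT cardsU.
    by move: meet (card_edge_leq2 e); rewrite -card_gt0; lia.
(* No edge of [S] outside [T] meets [T], so [T] is a union of connected
   components of [S]; this contradicts [t \in T] and [s \notin T]. *)
rewrite negb_exists_in => /forall_inP sep.
have cross e f : e \in T -> f \in S -> adj e f -> f \in T.
  move=> eT fS /andP[_ ef]; apply: contraT => fNT.
  have := sep f; rewrite inE fNT fS negbK => /(_ isT)/eqP fT0.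
  case/set0Pn: ef => x; rewrite inE => /andP[xe xf].
  have : x \in val f :&: covered T.
    by rewrite inE xf; apply/bigcupP; exists e.
  by rewrite fT0 inE.
have closT : fingraph.closed (@adj (Defs.induced S)) [pred u : Defs.induced S | val u \in T].
  move=> u v uv; apply/idP/idP => /= inT.
  - exact: cross inT (valP v) uv.
  - by apply: cross inT (valP u) _; rewrite adj_sym.
have tS := fintype.subsetP TS t tT.
have ts := forallP (conS (exist _ t tS)) (exist _ s sS).
by move: (closed_connect closT ts); rewrite !inE /= tT (negPf sNT).
Qed.

(** Every color occurs on an edge that meets the class of [i]: by completeness
    if the color is not [i], and because the class of [i] is nonempty
    otherwise.  Distinct colors use distinct edges, and at most [#|G|] edges
    pass through each covered vertex. *)
Lemma colors_leq_covered k (c : {ffun line_graph G -> 'I_k}) (i : 'I_k) :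
  connected_coloring c -> complete_coloring c ->
  k <= #|covered (color_class c i)| * #|G|.
Proof.
move=> /forallP con /forallP com; set V := covered _.
pose M := \bigcup_(x in V) [set e : line_graph G | x \in val e].
have inM e f x : c e = i -> x \in val e -> x \in val f -> f \in M.
  move=> ei xe xf; apply/bigcupP; exists x; last by rewrite inE.
  by apply/bigcupP; exists e => //; rewrite inE ei.
have hit : [set: 'I_k] \subset c @: M.
  apply/fintype.subsetP=> j _; apply/imsetP.
  have [->|neq] := eqVneq j i.
    have /andP[/card_gt0P[[e ei] _] _] := con i.
    have cei : c e = i by move: ei; rewrite inE => /eqP.
    have /set0Pn[x xe] := edge_neq0 e.
    by exists e; rewrite ?cei // (inM e e x).
  have := forallP (com i) j; rewrite eq_sym neq.
  case/exists_inP=> e; rewrite inE => /eqP ei.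
  case/exists_inP=> f; rewrite inE => /eqP fj.
  case/andP=> _ /set0Pn[x]; rewrite inE => /andP[xe xf].
  by exists f; rewrite ?fj // (inM e f x).
have kM : k <= #|M|.
  rewrite -[leqLHS]card_ord -cardsT.
  exact: leq_trans (subset_leq_card hit) (leq_imset_card _ _).
apply: (leq_trans kM); rewrite -sum_nat_const.
apply: (@leq_trans (\sum_(x in V) #|[set e : line_graph G | x \in val e]|)).
  rewrite /M; elim/big_rec2: _ => [|x m A _ mA]; first by rewrite cards0.
  by rewrite cardsU; lia.
by apply: leq_sum => x _; apply: card_edges_at_leq.
Qed.

Lemma cc_coloring_quadratic_bound k :
  has_cc_coloring (line_graph G) k ->
  2 * k ^ 2 <= #|G| ^ 3 + 2 * k * #|G|.
Proof.
case: k => [|k]; first by rewrite muln0.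
case/existsP=> c /andP[con com].
have [i _ imin] := arg_minnP (fun j => #|color_class c j|) (erefl (xpredT ord0)).
have covS : #|covered (color_class c i)| <= #|color_class c i|.+1.
  by apply: card_covered_connected; apply: (forallP con).
have kV := colors_leq_covered _ c i con com.
have classes : k.+1 * #|color_class c i| <= #|line_graph G|.
  have -> : #|line_graph G| = \sum_j #|color_class c j|.
    rewrite -sum1_card (partition_big c xpredT) //=.
    by apply: eq_bigr => j _; rewrite -sum1_card; apply: eq_bigl => e; rewrite inE.
  rewrite -[X in X * _ <= _]card_ord -sum_nat_const.
  by apply: leq_sum => j _; apply: imin.
have edges2 := card_edges_leq.
move: classes edges2 kV covS.
move: #|color_class c i| #|covered _| #|line_graph G| #|G| => e v m n.
move=> kem mn kvn ve.
have ken : k.+1 <= e.+1 * n by apply: leq_trans kvn _; rewrite leq_mul2r ve orbT.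
have kkn : k.+1 * k.+1 <= k.+1 * (e.+1 * n) by rewrite leq_mul2l ken orbT.
have ke2 : 2 * (k.+1 * e) * n <= n ^ 2 * n by rewrite leq_mul2r; lia.
have -> : n ^ 3 = n ^ 2 * n by rewrite expnSr.
by rewrite -mulnn; lia.
Qed.

(** A maximum over an empty range is [0], which also satisfies the bound; so it
    passes from each admissible [k] to the maximum that defines the index. *)
Lemma index_quadratic_bound :
  let k := connected_pseudoachromatic_index G in
  2 * k ^ 2 <= #|G| ^ 3 + 2 * k * #|G|.
Proof.
rewrite /= /connected_pseudoachromatic_index /psi_c.
apply: (big_ind (fun k => 2 * k ^ 2 <= #|G| ^ 3 + 2 * k * #|G|)).
- by rewrite muln0.
- by move=> p q; rewrite /maxn; case: ifP.
- by move=> k; apply: cc_coloring_quadratic_bound.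
Qed.

End LineGraphColorings.

Theorem theorem2 (R : realType) :
  exists h : nat -> R, Theta_n h /\
    forall n : nat, (8 <= n)%N ->
      (connected_pseudoachromatic_index (complete_graph n))%:R
        <= (Num.sqrt (2%:R : R))^-1 * n%:R `^ (3%:R / 2%:R) + h n.
Proof.
exists (fun n => n%:R); split.
  exists 1, 1; split => //; apply: nearW => n.
  by rewrite mul1r normr_nat.
move=> n _; set a : R := _ * _.
have a_ge0 : 0 <= a by rewrite mulr_ge0 ?invr_ge0 ?sqrtr_ge0 ?powR_ge0.
have a2 : 2 * a ^+ 2 = n%:R ^+ 3.
  rewrite exprMn exprVn sqr_sqrtr // mulrA mulfV ?mul1r ?pnatr_eq0 //.
  rewrite -[X in X = _]powR_mulrn ?powR_ge0 // -powRrM divfK ?pnatr_eq0 //.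
  by rewrite powR_mulrn.
have := index_quadratic_bound (complete_graph n); rewrite /= card_ord.
move: (connected_pseudoachromatic_index _) => k.
rewrite -(ler_nat R) !(natrX, natrD, natrM) -a2 => kn.
(* If [k > a + n], then [k * (k - n) > a ^ 2]. *)
have n_ge0 : 0 <= n%:R :> R by [].
rewrite leNgt; apply/negP => lt_k.
nra.
Qed.
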